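(* Let $X$ and $Y$ be independent random variables with distributions $F$ and $G$, respectively, supported on $[0,\infty)$, and let $H$ be the distribution of the product $XY$. (i) If $\lim_{x\to\infty} x^{\delta_1}\overline{F}(x)=\infty$ for some $\delta_1>0$, then $$\lim_{x\to\infty} x^{\delta_1}\overline{H}(x)=\infty,$$ which is equivalent to the property that $\overline{V}(x)=o\big(\overline{H}(x)\big)$ for each distribution $V$ satisfying $\int_0^\infty y^\delta\, V(dy)<\infty$ for all $\delta>0$. In this case, for each such $V$, also $\overline{V}(cx)=o\big(\overline{H}(x)\big)$ for each $c>0$. Further, if in addition $F\in\mathcal{L}$ and $\int_0^\infty y^\delta\, G(dy)<\infty$ for all $\delta>0$, then $H\in\mathcal{L}$. (ii) If $\lim_{x\to\infty} x^{\delta}\max\big\{\overline{G}(x),\overline{F}(x)\big\}=0$ for each $\delta>0$, then $$\lim_{x\to\infty} x^{\delta}\overline{H}(x)=0\quad\text{for each }\delta>0,$$ and $H\notin\mathcal{D}$.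
   Context: For a distribution $V$ (i.e. distribution function), $\overline V=1-V$ denotes its tail. Saying that $F$ and $G$ are supported on $[0,\infty)$ means that they are concentrated on $[0,\infty)$ with tails $\overline F(x)>0$ and $\overline G(x)>0$ for all $x\ge 0$. For functions $f$ and $g$ with $g>0$, $f(x)=o(g(x))$ and $f(x)=O(g(x))$ are understood as $x\to\infty$. A distribution $V$ on $(-\infty,\infty)$ belongs to the long-tailed class $\mathcal{L}$ if $\lim_{x\to\infty}\overline V(x-t)/\overline V(x)=1$ for each $t\in(-\infty,\infty)$. A distribution $V$ on $(-\infty,\infty)$ belongs to the class $\mathcal{D}$ of dominatedly varying tails if $\overline V(tx)=O\big(\overline V(x)\big)$ for each $0<t<1$. *)

(* Defs.v *)
From HB Require Import structures.
From mathcomp Require Import all_boot all_order all_algebra.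
From mathcomp Require Import all_classical all_reals all_analysis.
From mathcomp Require Import measurable_realfun.

Set Implicit Arguments.
Unset Strict Implicit.
Unset Printing Implicit Defensive.

Import Order.TTheory GRing.Theory Num.Theory.
Import numFieldNormedType.Exports.

Local Open Scope classical_set_scope.
Local Open Scope ring_scope.

(* The Landau notations of mathcomp-analysis expect a filter_on structure. *)
Canonical pinfty_nbhs_filter_on (R : numFieldType) : filter_on R :=
  FilterType (pinfty_nbhs R) _.

(* A distribution on (-oo, +oo) is a Borel probability measure on R. *)

Definition tail (R : realType) (V : probability R R) (x : R) : R :=
  1 - fine (V `]-oo, x]%classic).

Definition supported_on_nonneg (R : realType) (V : probability R R) : Prop :=
  V `]-oo, 0[%classic = 0%E /\ forall x : R, 0 <= x -> 0 < tail V x.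

Definition independent_RVs (d : measure_display) (T : measurableType d)
    (R : realType) (P : probability T R) (X Y : {RV P >-> R}) : Prop :=
  forall A B : set R, measurable A -> measurable B ->
    P (X @^-1` A `&` Y @^-1` B) = (P (X @^-1` A) * P (Y @^-1` B))%E.

Definition long_tailed (R : realType) (V : probability R R) : Prop :=
  forall t : R, tail V (x - t) / tail V x @[x --> +oo] --> (1 : R).

Definition dominatedly_varying (R : realType) (V : probability R R) : Prop :=
  forall t : R, 0 < t < 1 ->
    (fun x : R => tail V (t * x)) =O_ (pinfty_nbhs R) (tail V).

Definition all_moments_finite (R : realType) (V : probability R R) : Prop :=
  forall delta : R, 0 < delta ->
    (\int[V]_(y in `[0%R, +oo[) (y `^ delta)%:E < +oo)%E.

Definition dominates_light_tails (R : realType) (H : probability R R) : Prop :=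
  forall V : probability R R, all_moments_finite V ->
    tail V =o_ (pinfty_nbhs R) (tail H).

(* Main.v *)
Require Import Defs.
From HB Require Import structures.
From mathcomp Require Import all_boot all_order all_algebra.
From mathcomp Require Import all_classical all_reals all_analysis.
From mathcomp Require Import measurable_realfun.
From mathcomp Require Import ring lra.

Set Implicit Arguments.
Unset Strict Implicit.
Unset Printing Implicit Defensive.

Import Order.TTheory GRing.Theory Num.Theory.
Import numFieldNormedType.Exports.

Local Open Scope classical_set_scope.
Local Open Scope ring_scope.

(** The tail of the product is controlled from below by one rectangle and from
    above by two half-planes.  For u, v >= 0, independence gives
      tail F u * tail G v <= tail H (u * v)             (tail_mul_ge)
    and, X and Y being nonnegative, XY > s^2 forces X > s or Y > s, so
      tail H (s^2) <= tail F s + tail G s               (tail_mul_le).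

    Part (i).  With v = 1 the first bound transfers x^delta * tail -> oo from F
    to H.  If x^delta * tail H x -> oo and V has all moments, Markov's
    inequality bounds x^delta * tail V x, hence tail V (c x) = o(tail H x).
    Conversely, if no power of x makes tail H blow up, there are points
    a_n -> oo with tail H a_n <= a_n^-n; the discrete law with atoms at
    2 a_n, of mass proportional to a_n^-n, has all moments, yet its tail is
    at least a constant times tail H along the a_n.

    For the long-tailedness of H, fix t > 0 and bound the mass of (x - t, x] by
    splitting on the value y of Y (tail_mul_increment).  For eps < y <= x / u0,
    dividing by y turns the window into one of length at most t / eps ending
    at x / y >= u0, whose mass is a small fraction of tail F (x / y) because F
    is long-tailed; integrating in y gives a small multiple of tail H x.  Large
    y contribute at most tail G (x / u0) = o(tail H x).  Small y, where
    t / y is unbounded, cannot be handled by long-tailedness; they contribute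
    at most tail F (x / (2 eps)) * P(0 < Y <= eps), while
    tail H x >= tail F (x / (2 eps)) * tail G (2 eps), and P(0 < Y <= eps)
    tends to 0 with eps.

    Part (ii).  The second bound at s = sqrt x gives the rapid decay of tail H.
    A dominatedly varying positive tail satisfies
    tail (x / 2) <= k * tail x for large x, so along x = 2^n M it decays at most
    geometrically in n, that is at most like a power of x, and H cannot be
    dominatedly varying. *)

(** * Tails of distributions *)

Lemma tailE (R : realType) (V : probability R R) (x : R) :
  (tail V x)%:E = V `]x, +oo[%classic.
Proof.
rewrite /tail EFinB fineK ?fin_num_measure//.
by rewrite -probability_setC// setCitvl.
Qed.

Lemma tail_ge0 (R : realType) (V : probability R R) (x : R) : 0 <= tail V x.
Proof. by rewrite -lee_fin tailE measure_ge0. Qed.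

Lemma tail_anti (R : realType) (V : probability R R) (x y : R) :
  x <= y -> tail V y <= tail V x.
Proof.
move=> xy; rewrite -lee_fin !tailE le_measure ?inE//.
by apply: subset_itvr; rewrite bnd_simp.
Qed.

Lemma near_pinftyP (R : realType) (Q : R -> Prop) :
  (\forall x \near +oo, Q x) <-> exists M : R, 0 < M /\ forall x, M <= x -> Q x.
Proof.
split=> [[M [_ MQ]]|[M [M0 MQ]]]; last first.
  by exists M; split; [exact: num_real|move=> x /ltW /MQ].
exists (Num.max 0 M + 1); split; first by rewrite ltr_wpDl ?le_max ?lexx.
move=> x Mx; apply: MQ; rewrite (lt_le_trans _ Mx)//.
by rewrite (@le_lt_trans _ _ (Num.max 0 M)) ?ltrDl// le_max lexx orbT.
Qed.

Lemma eqo_nearP (R : realType) (f g : R -> R) :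
  (forall x, 0 <= f x) -> (forall x, 0 <= g x) ->
  f =o_ (pinfty_nbhs R) g <->
  forall eps, 0 < eps -> \forall x \near +oo, f x <= eps * g x.
Proof.
move=> f0 g0; rewrite eqoP; split => fg e e0; have := fg e e0;
  by apply: filterS => x; rewrite !ger0_norm.
Qed.

(** * Tails of distributions with all moments *)

Lemma markov_tail (R : realType) (V : probability R R) (delta : R) :
  0 < delta -> all_moments_finite V ->
  exists C : R, 0 < C /\ forall x, 0 < x -> x `^ delta * tail V x <= C.
Proof.
move=> d0 /(_ _ d0) moment.
set I := (\int[V]_(y in _) _)%E in moment.
have I0 : (0 <= I)%E by apply: integral_ge0 => y _; rewrite lee_fin powR_ge0.
have Ifin : I \is a fin_num by rewrite ge0_fin_numE.
exists (fine I + 1); split; first by rewrite ltr_wpDl ?fine_ge0.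
move=> x x0; rewrite (@le_trans _ _ (fine I)) ?lerDl//.
rewrite -lee_fin fineK// EFinM tailE -integral_cst//.
have mp D : measurable_fun D (fun y : R => (y `^ delta)%:E).
  by apply/measurable_EFinP; apply: measurable_funTS; exact: measurable_powR.
apply: (@le_trans _ _ (\int[V]_(y in `]x, +oo[) (y `^ delta)%:E)%E).
  apply: ge0_le_integral => //.
  - by move=> y _; rewrite /= lee_fin powR_ge0.
  - move=> y /=; rewrite in_itv/= andbT => xy; rewrite lee_fin.
    by rewrite ge0_ler_powR ?nnegrE ?ltW// (lt_trans x0).
apply: ge0_subset_integral => //.
- by move=> y _; rewrite lee_fin powR_ge0.
- by apply: subset_itvr; rewrite bnd_simp ltW.
Qed.

(** The dilation by c only costs the constant factor c^delta in Markov's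
    inequality. *)
Lemma light_tail_eqo (R : realType) (V : probability R R) (h : R -> R)
    (delta c : R) :
  (forall x, 0 <= h x) -> 0 < delta -> 0 < c -> all_moments_finite V ->
  x `^ delta * h x @[x --> +oo] --> +oo ->
  (fun x => tail V (c * x)) =o_ (pinfty_nbhs R) h.
Proof.
move=> h0 d0 c0 Vlight hoo.
have [C [C0 VC]] := markov_tail d0 Vlight.
apply/eqo_nearP => // [x|eps e0]; first exact: tail_ge0.
have /cvgryPge/(_ (C / (eps * c `^ delta))) hC := hoo.
near=> x.
have x0 : 0 < x by near: x; exact: nbhs_pinfty_gt.
have := VC _ (mulr_gt0 c0 x0).
rewrite (powRM _ (ltW c0) (ltW x0)).
have : C / (eps * c `^ delta) <= x `^ delta * h x by near: x.
have p0 := powR_gt0 delta x0; have q0 := powR_gt0 delta c0.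
rewrite ler_pdivrMr ?mulr_gt0// => A B.
rewrite -(ler_pM2l (mulr_gt0 q0 p0)); apply: (le_trans (le_trans B A)).
by rewrite le_eqVlt; apply/orP; left; apply/eqP; ring.
Unshelve. all: by end_near. Qed.

(** From index m on, the general term is at most 2^m * 2^(m - k) since a k >= 2,
    so the whole series is dominated by a geometric one; the finitely many
    earlier terms are absorbed in the constant. *)
Lemma moment_series_lty (R : realType) (a : nat -> R) (m : nat) :
  (forall n, 2 <= a n) ->
  (\sum_(0 <= k <oo) ((a k)^-1 ^+ k * (2 * a k) ^+ m)%:E < +oo)%E.
Proof.
move=> a2.
have a0 n : 0 < a n by rewrite (lt_le_trans _ (a2 n)).
pose u k := (a k)^-1 ^+ k * (2 * a k) ^+ m.
have u0 k : 0 <= u k.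
  by rewrite mulr_ge0// exprn_ge0// ?invr_ge0 ?mulr_ge0// ltW.
pose K := 2 ^+ m * 2 ^+ m * 2 + \sum_(i < m) u i * (2 ^ i.+1)%:R.
have s0 (P : pred 'I_m) : 0 <= \sum_(i < m | P i) u i * (2 ^ i.+1)%:R.
  by apply: sumr_ge0 => i _; rewrite mulr_ge0.
have K0 : 0 <= K by rewrite addr_ge0 ?mulr_ge0.
have uK k : u k <= K / (2 ^ k.+1)%:R.
  rewrite ler_pdivlMr ?ltr0n ?expn_gt0//.
  have [mk|km] := leqP m k; last first.
    rewrite /K (bigD1 (Ordinal km))//= addrCA lerDl addr_ge0// ?mulr_ge0//.
  apply: (@le_trans _ _ (2 ^+ m * 2 ^+ m * 2)); last by rewrite /K lerDl.
  rewrite /u; move: (a k) (a0 k) (a2 k) => b b0 b2.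
  rewrite -(subnKC mk) natrX exprMn -addnS !exprD exprS.
  have -> : b^-1 ^+ m * b^-1 ^+ (k - m) * (2 ^+ m * b ^+ m) *
      (2 ^+ m * (2 * 2 ^+ (k - m))) = 2 ^+ m * 2 ^+ m * 2 *
      ((b^-1 * b) ^+ m * (b^-1 * 2) ^+ (k - m)).
    by rewrite !exprMn; ring.
  rewrite mulVf ?gt_eqF// expr1n mul1r ler_piMr ?mulr_ge0//.
  rewrite exprn_ile1 ?mulr_ge0 ?invr_ge0 ?(ltW b0)//.
  by rewrite mulrC ler_pdivrMr ?mul1r.
apply: (@le_lt_trans _ _ (\sum_(0 <= k <oo) (0 + (K / (2 ^ k.+1)%:R)%:E))%E).
  apply: lee_nneseries => [k _ _|k _]; first by rewrite lee_fin; exact: u0.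
  by rewrite add0e lee_fin uK.
apply: (le_lt_trans (@epsilon_trick R (fun=> 0%E) K xpredT _ K0)) => //.
by rewrite eseries0// add0e ltry.
Qed.

(** The law is the normalization of the sum over n of (a n)^-n times the Dirac
    mass at 2 (a n).  The exponent n in the weights eventually beats every fixed
    power of a n, whatever the growth of the sequence. *)
Lemma exists_light_tail_atoms (R : realType) (a : nat -> R) :
  (forall n, 2 <= a n) ->
  exists V : probability R R, all_moments_finite V /\
    exists c : R, 0 < c /\ forall n, c * (a n)^-1 ^+ n <= tail V (a n).
Proof.
move=> a2.
have a0 n : 0 < a n by rewrite (lt_le_trans _ (a2 n)).
have p0 n : 0 <= (a n)^-1 ^+ n by rewrite exprn_ge0// invr_ge0 ltW.
pose m_ n : {measure set R -> \bar R} := mscale (NngNum (p0 n)) \d_(2 * a n).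
pose mu : {measure set R -> \bar R} := mseries m_ 0.
pose V : probability R R := mnormalize mu \d_(0:R).
have muint (f : R -> \bar R) D : measurable D -> measurable_fun D f ->
    (forall t, D t -> (0 <= f t)%E) -> (forall n, D (2 * a n)) ->
    (\int[mu]_(x in D) f x =
     \sum_(0 <= n <oo) (((a n)^-1 ^+ n)%:E * f (2 * a n)%R))%E.
  move=> mD mf f0 Da; rewrite ge0_integral_measure_series//.
  apply: eq_eseriesr => n _; rewrite ge0_integral_mscale//= integral_dirac//.
  by rewrite diracE mem_set// mul1e.
pose e := mu setT.
have eE : e = (\sum_(0 <= n <oo) ((a n)^-1 ^+ n * (2 * a n) ^+ 0)%:E)%E.
  rewrite /e /mu/= /mseries; apply: eq_eseriesr => n _.
  by rewrite /m_ /= /mscale/= diracT mule1 expr0 mulr1.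
have eoo : (e < +oo)%E by rewrite eE moment_series_lty.
have mun n : (((a n)^-1 ^+ n)%:E <= mu `]a n, +oo[%classic)%E.
  rewrite /mu/= /mseries.
  rewrite (nneseries_split 0 n.+1)//= add0n.
  rewrite big_nat_recr//= /mscale/= diracE mem_set; last first.
    by rewrite /= in_itv/= andbT ltr_pMl// ltr1n.
  rewrite mule1 -addeA addeCA leeDl// adde_ge0//.
    by apply: sume_ge0 => i _; rewrite mule_ge0// lee_fin.
  by apply: nneseries_ge0 => i _ _; rewrite mule_ge0// lee_fin.
(* The term n = 0 alone has mass 1. *)
have e1 : (1 <= e)%E.
  apply: (@le_trans _ _ (mu `]a 0%N, +oo[%classic)).
    by have := mun 0%N; rewrite expr0.
  by rewrite le_measure ?inE.
have e0 : (0 < fine e).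
  by rewrite fine_gt0// eoo andbT (lt_le_trans _ e1).
have VE A : V A = (mu A * (fine e)^-1%:E)%E.
  rewrite /V/= /mnormalize/= -/e gt_eqF ?(lt_le_trans _ e1)//=.
  by rewrite lt_eqF.
exists V; split; last first.
  exists (fine e)^-1; split; first by rewrite invr_gt0.
  move=> n; rewrite -lee_fin tailE VE mulrC EFinM lee_wpmul2r//.
  by rewrite lee_fin invr_ge0 ltW.
move=> delta d0.
(* Since 2 (a n) >= 1, an integer moment of larger order suffices. *)
pose m := (Num.truncn delta).+1.
have dm : delta <= m%:R by rewrite ltW// truncnS_gt.
have k0 : 0 <= (fine e)^-1 by rewrite invr_ge0 ltW.
have mp D : measurable_fun D (fun y : R => (y `^ delta)%:E).
  by apply/measurable_EFinP; apply: measurable_funTS; exact: measurable_powR.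
rewrite (@eq_measure_integral _ _ _ _ (mscale (NngNum k0) mu)); last first.
  by move=> A _ _; rewrite -[LHS]/(V A) VE muleC.
rewrite ge0_integral_mscale//; last by move=> y _; rewrite lee_fin powR_ge0.
rewrite muint//; first last.
- by move=> n; rewrite /= in_itv/= andbT mulr_ge0// ltW.
- by move=> y _; rewrite lee_fin powR_ge0.
rewrite lte_mul_pinfty//.
apply: le_lt_trans (moment_series_lty m a2).
apply: lee_nneseries => [n _ _|n _].
  by rewrite -EFinM lee_fin mulr_ge0// powR_ge0.
rewrite -EFinM lee_fin ler_wpM2l// -powR_mulrn ?mulr_ge0 ?(ltW (a0 n))//.
by apply: ler_powR dm; have := a2 n; lra.
Qed.

(** By contraposition, the points a n at which tail H lies below (a n)^-n carry
    a distribution with all moments whose tail is not o(tail H). *)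
Lemma dominates_light_tails_moment (R : realType) (H : probability R R) :
  dominates_light_tails H ->
  exists delta : R, 0 < delta /\ x `^ delta * tail H x @[x --> +oo] --> +oo.
Proof.
move=> Hdom; apply: contrapT => noexp.
have /choice[a aP] : forall n, exists x : R,
    2 + n%:R <= x /\ x ^+ n * tail H x <= 1.
  (* If x^n * tail H x > 1 for all large x, then x^(n + 1) * tail H x > x. *)
  move=> n; apply: contrapT => nox; apply: noexp; exists n.+1%:R.
  split; first by rewrite ltr0n.
  apply/cvgryPge => M; near=> x.
  have x2 : 2 + n%:R <= x by near: x; apply: nbhs_pinfty_ge; exact: num_real.
  have x0 : 0 < x by rewrite (lt_le_trans _ x2)// ltr_pwDl.
  have xM : M <= x by near: x; apply: nbhs_pinfty_ge; exact: num_real.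
  rewrite powR_mulrn ?(ltW x0)// exprS -mulrA (le_trans xM)//.
  rewrite ler_peMr ?(ltW x0)//.
  by rewrite leNgt; apply/negP => /ltW ?; apply: nox; exists x.
have a2 n : 2 <= a n by have [+ _] := aP n; apply: le_trans; rewrite lerDl.
have a0 n : 0 < a n by rewrite (lt_le_trans _ (a2 n)).
have [V [Vlight [c [c0 Vc]]]] := exists_light_tail_atoms a2.
have /eqo_nearP VH := Hdom _ Vlight.
have c2 : 0 < c / 2 by rewrite divr_gt0.
have /near_pinftyP[M [_ HM]] := VH (@tail_ge0 _ _) (@tail_ge0 _ _) _ c2.
(* At x = a n the little-o bound with constant c / 2 would give c <= c / 2. *)
pose n := (Num.truncn M).+1.
have [an Hn] := aP n.
have Man : M <= a n.
  by rewrite (le_trans _ an)// (le_trans (ltW (truncnS_gt M)))// lerDr.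
have := le_trans (Vc n) (HM _ Man).
have pn : 0 < (a n)^-1 ^+ n by rewrite exprn_gt0// invr_gt0.
have : tail H (a n) <= (a n)^-1 ^+ n.
  by rewrite exprVn -[leRHS]mul1r ler_pdivlMr ?exprn_gt0// mulrC.
rewrite -(ler_pM2l c2) => A B; have := le_trans B A.
by rewrite ler_pM2r//; lra.
Unshelve. all: by end_near. Qed.

(** * Products of independent random variables *)

(** The law of (X, Y) and both iterated product measures agree on rectangles,
    hence everywhere; sections are taken at a fixed value of Y. *)
Lemma independent_joint_law (R : realType) (d : measure_display)
    (T : measurableType d) (P : probability T R) (X Y : {RV P >-> R})
    (A : set (R * R)) :
  independent_RVs X Y -> measurable A ->
  P [set w | A (X w, Y w)] =
  (\int[distribution P Y]_y distribution P X (ysection A y))%E.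
Proof.
move=> indXY mA.
have mXY : measurable_fun setT (fun w => (X w, Y w)).
  by apply: measurable_fun_pair; exact: measurable_funP.
pose Z : {mfun T >-> (R * R)%type} := mfun_Sub (mem_set mXY).
rewrite -[RHS]/((distribution P X \x^ distribution P Y)%E A).
rewrite -[LHS]/(distribution P Z A).
rewrite -(@product_measure_unique _ _ _ _ _
  (distribution P X) (distribution P Y) (distribution P Z))//.
by apply: product_measure_unique => // B C mB mC; rewrite /= product_measure2E.
Qed.

(** A comparison valid conditionally on each value of Y integrates to a
    comparison of probabilities. *)
Lemma independent_le_sections (R : realType) (d : measure_display)
    (T : measurableType d) (P : probability T R) (X Y : {RV P >-> R})
    (A C : set (R * R)) (k : R) :
  independent_RVs X Y -> measurable A -> measurable C -> 0 <= k ->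
  (forall y, (distribution P X (ysection A y) <=
     k%:E * distribution P X (ysection C y))%E) ->
  (P [set w | A (X w, Y w)] <= k%:E * P [set w | C (X w, Y w)])%E.
Proof.
move=> indXY mA mC k0 AC.
rewrite !independent_joint_law// -ge0_integralZl_EFin//;
  last exact: measurable_fun_ysection.
apply: ge0_le_integral => //.
  exact: measurable_fun_ysection.
by apply: measurable_funeM; exact: measurable_fun_ysection.
Qed.

Lemma tail_itv (R : realType) (V : probability R R) (a b : R) :
  a <= b -> (tail V a - tail V b)%:E = V `]a, b]%classic.
Proof.
move=> ab; rewrite EFinB !tailE.
rewrite (@itv_bndbnd_setU _ _ (BRight a) (BRight b) +oo%O)//.
rewrite measureU//.
  by rewrite addeK// fin_num_measure.
by apply/seteqP; split => // z /=; rewrite !in_itv/= andbT => -[/andP[_ zb]];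
  rewrite ltNge zb.
Qed.

Lemma tail_mul_ge (R : realType) (d : measure_display) (T : measurableType d)
    (P : probability T R) (X Y : {RV P >-> R}) (u v : R) :
  independent_RVs X Y -> 0 <= u -> 0 <= v ->
  tail (distribution P X) u * tail (distribution P Y) v <=
  tail (distribution P (X \* Y : {RV P >-> R})) (u * v).
Proof.
move=> indXY u0 v0; rewrite -lee_fin EFinM !tailE /distribution /pushforward.
rewrite -indXY//; apply: le_measure; rewrite ?inE.
- by apply: measurableI; exact: measurable_funPTI.
- exact: measurable_funPTI.
move=> w /=; rewrite !in_itv/= !andbT => -[uX vY].
by apply: (le_lt_trans _ (ltr_pM _ _ uX vY)).
Qed.

Lemma tail_mul_le (R : realType) (d : measure_display) (T : measurableType d)
    (P : probability T R) (X Y : {RV P >-> R}) (s : R) :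
  distribution P X `]-oo, 0[%classic = 0%E ->
  distribution P Y `]-oo, 0[%classic = 0%E -> 0 <= s ->
  tail (distribution P (X \* Y : {RV P >-> R})) (s ^+ 2) <=
  tail (distribution P X) s + tail (distribution P Y) s.
Proof.
move=> X0 Y0 s0; rewrite -lee_fin (EFinD (tail _ _)) !tailE.
have mp (Z : {RV P >-> R}) (i : interval R) : measurable (Z @^-1` [set` i]).
  exact: measurable_funPTI.
pose N := X @^-1` `]-oo, 0[ `|` Y @^-1` `]-oo, 0[.
pose B := X @^-1` `]s, +oo[ `|` Y @^-1` `]s, +oo[.
have mB : measurable B by apply: measurableU; exact: mp.
have mN : measurable N by apply: measurableU; exact: mp.
have PN : P N = 0%E.
  apply/eqP; rewrite eq_le measure_ge0 andbT.
  have : (P N <= distribution P X `]-oo, 0%R[%classic +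
      distribution P Y `]-oo, 0%R[%classic)%E.
    by apply: measureU2; exact: mp.
  by rewrite X0 Y0 adde0.
apply: (@le_trans _ _ (P (B `|` N))); last first.
  rewrite -[leRHS]adde0 -PN; apply: (le_trans (measureU2 _ mB mN)).
  by rewrite leeD2r//; apply: measureU2; exact: mp.
rewrite -[leLHS]/(P ((X \* Y : {RV P >-> R}) @^-1` `]s ^+ 2, +oo[)).
apply: le_measure; rewrite ?inE//; [exact: measurableU|].
move=> w /=; rewrite /B /N /= !in_itv/= !andbT expr2 => sXY.
apply: contrapT.
move=> /not_orP[/not_orP[/negP + /negP +] /not_orP[/negP + /negP +]].
rewrite -!leNgt => Xs Ys X0w Y0w.
by move: sXY; rewrite ltNge ler_pM.
Qed.

(** The event x - t < XY <= x is covered by four events according to Y: the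
    window eps < Y <= x / u0, the range Y > x / u0, the range 0 < Y <= eps
    (where X > (x - t) / eps), and the null event Y < 0. *)
Lemma tail_mul_increment (R : realType) (d : measure_display)
    (T : measurableType d) (P : probability T R) (X Y : {RV P >-> R})
    (H := distribution P (X \* Y : {RV P >-> R}) : probability R R)
    (t eps u0 eta x : R) :
  independent_RVs X Y -> distribution P Y `]-oo, 0[%classic = 0%E ->
  0 < t -> 0 < eps -> 0 < u0 -> 0 <= eta -> t < x ->
  (forall u, u0 <= u ->
     tail (distribution P X) (u - t / eps) - tail (distribution P X) u <=
     eta * tail (distribution P X) u) ->
  tail H (x - t) - tail H x <=
    eta * tail H x + tail (distribution P Y) (x / u0) +
    tail (distribution P X) ((x - t) / eps) *
      (tail (distribution P Y) 0 - tail (distribution P Y) eps).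
Proof.
move=> indXY Y0 t0 eps0 u00 eta0 tx Xlong.
have x0 : 0 < x by exact: lt_trans tx.
have mp (Z : {RV P >-> R}) (i : interval R) : measurable (Z @^-1` [set` i]).
  exact: measurable_funPTI.
pose M (z : R * R) := z.1 * z.2.
pose A := M @^-1` `]x - t, x] `&` snd @^-1` `]eps, x / u0].
pose C := M @^-1` `]x, +oo[.
have mM : measurable_fun setT M.
  by apply: measurable_funM; [exact: measurable_fst|exact: measurable_snd].
have mpM (i : interval R) : measurable (M @^-1` [set` i]).
  by rewrite -[X in measurable X]setTI; apply: mM.
have mA : measurable A.
  apply: measurableI; first exact: mpM.
  by rewrite -[X in measurable X]setTI; apply: measurable_snd.
have mC : measurable C by exact: mpM.
have sections y : (distribution P X (ysection A y) <=
    eta%:E * distribution P X (ysection C y))%E.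
  have [yin|yout] := boolP (y \in `]eps, x / u0]); last first.
    rewrite [ysection A y](_ : _ = set0) ?measure0 ?mule_ge0//.
    by apply/seteqP; split => // z; rewrite /ysection/= inE => -[_]/=;
      rewrite (negbTE yout).
  have := yin; rewrite in_itv/= => /andP[epsy yu0].
  have y0 : 0 < y by exact: lt_trans epsy.
  have -> : ysection C y = `]x / y, +oo[%classic.
    apply/seteqP; split => z; rewrite /ysection/= inE /C /M/= !in_itv/= !andbT;
      by rewrite ltr_pdivrMr.
  (* As eps < y, the window of length t / y lies in one of length t / eps. *)
  apply: (@le_trans _ _ (distribution P X `]x / y - t / eps, x / y]%classic)).
    apply: le_measure; rewrite ?inE//; first exact: measurable_ysection.
    move=> z; rewrite /ysection/= inE /A /M/= !in_itv/= => -[/andP[xtz zx] _].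
    rewrite ler_pdivlMr// zx andbT.
    rewrite (@le_lt_trans _ _ ((x - t) / y))// ?ltr_pdivrMr//.
    by rewrite mulrBl lerB// ler_pM2l// lef_pV2 ?posrE// ltW.
  rewrite -tail_itv; last by rewrite gerBl divr_ge0 ?ltW.
  rewrite -tailE -EFinM lee_fin Xlong//.
  by rewrite ler_pdivlMr// mulrC -ler_pdivlMr.
have PA := independent_le_sections indXY mA mC eta0 sections.
have PC : P [set w | C (X w, Y w)] = (tail H x)%:E.
  by rewrite tailE.
rewrite PC in PA.
pose EA := [set w | A (X w, Y w)].
have mEA : measurable EA.
  have : measurable_fun setT (fun w => (X w, Y w)).
    by apply: measurable_fun_pair; exact: measurable_funP.
  by move=> /(_ measurableT _ mA); rewrite setTI.
pose EB := Y @^-1` `]x / u0, +oo[.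
pose EC := X @^-1` `](x - t) / eps, +oo[ `&` Y @^-1` `]0, eps].
pose EN := Y @^-1` `]-oo, 0[.
have PN : P EN = 0%E by [].
have PB : P EB = (tail (distribution P Y) (x / u0))%:E by rewrite tailE.
have PEC : P EC = (tail (distribution P X) ((x - t) / eps) *
    (tail (distribution P Y) 0 - tail (distribution P Y) eps))%:E.
  by rewrite (EFinM (tail _ _)) tailE tail_itv ?(ltW eps0)// -indXY.
have mEC : measurable EC by apply: measurableI; exact: mp.
rewrite -lee_fin tail_itv; last by rewrite gerBl ltW.
rewrite (EFinD (_ + _)) (EFinD (eta * _)) -PB -PEC.
rewrite -[X in (_ <= X)%E]adde0 -PN (EFinM eta).
have mEB : measurable EB by exact: mp.
have mEN : measurable EN by exact: mp.
have mAB : measurable (EA `|` EB) by exact: measurableU.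
have mABC : measurable (EA `|` EB `|` EC) by exact: measurableU.
apply: (@le_trans _ _ (P EA + P EB + P EC + P EN)%E); last first.
  by rewrite !leeD2r.
apply: (@le_trans _ _ (P (EA `|` EB `|` EC `|` EN))); last first.
  apply: (le_trans (measureU2 _ mABC mEN)); rewrite leeD2r//.
  apply: (le_trans (measureU2 _ mAB mEC)); rewrite leeD2r//.
  exact: measureU2.
rewrite -[leLHS]/(P ((X \* Y : {RV P >-> R}) @^-1` `]x - t, x])).
apply: le_measure; rewrite ?inE.
- exact: mp.
- exact: measurableU.
move=> w /= xtXY; rewrite /EA /EB /EC /EN /A /M /= !in_itv/= !andbT.
move: xtXY; rewrite in_itv/= => /andP[xtXY XYx].
have xt0 : 0 < x - t by rewrite subr_gt0.
have [Yneg|Ypos|YE] := ltgtP (Y w) 0; last 1 first.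
- by move: xtXY; rewrite YE mulr0 ltNge ltW.
- by right.
have [Yeps|epsY] := leP (Y w) eps.
  left; right; split => //.
  rewrite ltr_pdivrMr// (lt_le_trans xtXY)// ler_pM2l//.
  by rewrite -(pmulr_lgt0 _ Ypos) (lt_trans xt0).
by have [|] := leP (Y w) (x / u0) => ?; do 2 left; [left|right];
  rewrite ?xtXY ?XYx.
Qed.

(** * Long-tailed products *)

(** Tails being monotone, the ratio only has to be bounded on one side, and the
    shifts t < 0 reduce to t > 0 by translating x. *)
Lemma long_tailedP (R : realType) (V : probability R R) :
  (forall x : R, 0 <= x -> 0 < tail V x) ->
  long_tailed V <-> forall t eta : R, 0 < t -> 0 < eta ->
    \forall x \near +oo, tail V (x - t) - tail V x <= eta * tail V x.
Proof.
move=> V0.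
have ge0 : \forall x \near +oo, 0 <= x :> R.
  by apply: nbhs_pinfty_ge; exact: num_real.
split=> [Vlong t eta t0 eta0|Vlong t].
  have /cvgrPdist_le/(_ _ eta0) Vt := Vlong t; near=> x.
  have Vx : 0 < tail V x by apply: V0; near: x.
  have : `|1 - tail V (x - t) / tail V x| <= eta by near: x.
  rewrite distrC => /(le_trans (ler_norm _)).
  by rewrite lerBlDr ler_pdivrMr// mulrDl mul1r => ?; lra.
apply/cvgrPdist_le => eps eps0.
have dist x : 0 < tail V x -> `|1 - tail V (x - t) / tail V x| * tail V x =
    `|tail V x - tail V (x - t)|.
  move=> Vx; rewrite -[X in _ * X = _](gtr0_norm Vx) -normrM mulrBl mul1r.
  by rewrite divfK ?gt_eqF.
have [t0|t0|t0] := ltgtP t 0.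
- have Nt0 : 0 < - t by rewrite oppr_gt0.
  have /near_pinftyP[M [_ HM]] := Vlong _ _ Nt0 eps0.
  near=> x.
  have Vx : 0 < tail V x by apply: V0; near: x.
  have Mx : M <= x by near: x; apply: nbhs_pinfty_ge; exact: num_real.
  rewrite -(ler_pM2r Vx) dist// ger0_norm; last first.
    by rewrite subr_ge0 tail_anti// lerDl ltW.
  have := HM (x - t); rewrite opprK subrK => step.
  apply: (@le_trans _ _ (eps * tail V (x - t))).
    by apply: step; rewrite (le_trans Mx)// lerDl ltW.
  by rewrite ler_pM2l// tail_anti// lerDl ltW.
- have Vt := Vlong _ _ t0 eps0; near=> x.
  have Vx : 0 < tail V x by apply: V0; near: x.
  rewrite -(ler_pM2r Vx) dist// distrC ger0_norm; last first.
    by rewrite subr_ge0 tail_anti// gerBl ltW.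
  by near: x.
- near=> x; have Vx : 0 < tail V x by apply: V0; near: x.
  by rewrite t0 subr0 divff ?gt_eqF// subrr normr0 ltW.
Unshelve. all: by end_near. Qed.

(** The difference is P(0 < Y <= eps), which vanishes as eps -> 0 even when Y
    has an atom at 0.  The bound 1/2 on eps makes tail G (2 eps) at least
    tail G 1. *)
Lemma tail_right_continuous0 (R : realType) (d : measure_display)
    (T : measurableType d) (P : probability T R) (Y : {RV P >-> R}) (eta : R) :
  0 < eta -> exists eps : R, [/\ 0 < eps, eps <= 2^-1 &
    tail (distribution P Y) 0 - tail (distribution P Y) eps <= eta].
Proof.
move=> eta0.
have cdfE x : cdf Y x = (fine (cdf Y x))%:E by rewrite fineK ?fin_num_measure.
have := @cdf_right_continuous _ _ _ P Y 0; rewrite cdfE => /fine_cvgP[_].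
move=> /cvgrPdist_le/(_ _ eta0) H.
have near0 : \forall e \near (0 : R)^'+,
    `|fine (cdf Y 0) - (fine \o cdf Y) e| <= eta /\ 0 < e <= 2^-1.
  near=> e; split; first by near: e.
  apply/andP; split; first by near: e; exact: nbhs_right_gt.
  by near: e; apply: nbhs_right_le; rewrite invr_gt0.
have [e [He /andP[e0 e2]]] :=
  @filter_ex _ _ (at_right_proper_filter (0 : R)) _ near0.
exists e; split => //.
apply: le_trans He; rewrite distrC; apply: le_trans (ler_norm _).
by rewrite /tail /cdf/=; lra.
Unshelve. all: by end_near. Qed.

Lemma tail_mul_long_tailed (R : realType) (d : measure_display)
    (T : measurableType d) (P : probability T R) (X Y : {RV P >-> R})
    (H := distribution P (X \* Y : {RV P >-> R}) : probability R R)
    (delta : R) :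
  independent_RVs X Y ->
  supported_on_nonneg (distribution P X) ->
  supported_on_nonneg (distribution P Y) ->
  0 < delta -> x `^ delta * tail H x @[x --> +oo] --> +oo ->
  long_tailed (distribution P X) -> all_moments_finite (distribution P Y) ->
  long_tailed H.
Proof.
move=> indXY [_ F0] [Y0 G0] d0 Hoo Flong Glight.
have H0 x : 0 <= x -> 0 < tail H x.
  move=> x0; rewrite -[x]mulr1 (lt_le_trans _ (tail_mul_ge indXY _ _))//.
  by rewrite mulr_gt0 ?F0 ?G0.
apply/long_tailedP => // t eta t0 eta0.
pose e := eta / 3.
have e0 : 0 < e by rewrite divr_gt0.
have [eps [eps0 eps2 Geps]] :=
  @tail_right_continuous0 _ _ _ _ Y _ (mulr_gt0 e0 (G0 1 ler01)).
have Flong' := (long_tailedP F0).1 Flong.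
have /near_pinftyP[u0 [u00 Fu0]] := Flong' _ _ (divr_gt0 t0 eps0) e0.
have u0V : 0 < u0^-1 by rewrite invr_gt0.
have /eqo_nearP GH := light_tail_eqo (@tail_ge0 _ H) d0 u0V Glight Hoo.
have {}GH := GH (fun x => tail_ge0 _ _) (@tail_ge0 _ H) e e0.
near=> x.
have xt : 2 * t <= x by near: x; apply: nbhs_pinfty_ge; exact: num_real.
have GHx : tail (distribution P Y) (u0^-1 * x) <= e * tail H x by near: x.
have tx : t < x by lra.
apply: (le_trans (tail_mul_increment indXY Y0 t0 eps0 u00 (ltW e0) tx Fu0)).
rewrite -/H [x / u0]mulrC.
(* For x >= 2 t one has (x - t) / eps >= z, and z * (2 eps) = x. *)
pose z := x / (2 * eps).
have z0 : 0 <= z by rewrite divr_ge0//; lra.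
have Fz : tail (distribution P X) ((x - t) / eps) <= tail (distribution P X) z.
  apply: tail_anti; rewrite /z invfM mulrA ler_pM2r ?invr_gt0//; lra.
have FH : tail (distribution P X) z * tail (distribution P Y) 1 <= tail H x.
  apply: (@le_trans _ _
    (tail (distribution P X) z * tail (distribution P Y) (2 * eps))).
    by rewrite ler_wpM2l ?tail_ge0// tail_anti//; lra.
  have eps20 : 0 <= 2 * eps by lra.
  apply: (le_trans (tail_mul_ge indXY z0 eps20)).
  by rewrite /z divfK// gt_eqF//; lra.
have last_term : tail (distribution P X) ((x - t) / eps) *
    (tail (distribution P Y) 0 - tail (distribution P Y) eps) <= e * tail H x.
  apply: (@le_trans _ _
    (tail (distribution P X) z * (e * tail (distribution P Y) 1))).
    by rewrite ler_pM ?tail_ge0// subr_ge0 tail_anti// ltW.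
  by rewrite mulrCA ler_pM2l.
have -> : eta * tail H x = e * tail H x + e * tail H x + e * tail H x.
  by rewrite /e; field.
by rewrite !lerD.
Unshelve. all: by end_near. Qed.

(** * Rapidly decreasing products *)

(** If tail V (x / 2) <= k * tail V x beyond M and k <= 2^m, then x^m * tail V x
    does not decrease along x = 2^n M. *)
Lemma dominatedly_varying_power (R : realType) (V : probability R R) :
  (forall x : R, 0 <= x -> 0 < tail V x) -> dominatedly_varying V ->
  exists delta : R, 0 < delta /\
    ~ (x `^ delta * tail V x @[x --> +oo] --> (0 : R)).
Proof.
move=> V0 VD.
have half : 0 < (2^-1 : R) < 1 by apply/andP; split; lra.
have /eqO_exP[k k0 Vk] := VD _ half.
have /near_pinftyP[M [M0 HM]] := Vk.
pose m := (Num.truncn k).+1.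
have km : k <= 2 ^+ m.
  rewrite (le_trans (ltW (truncnS_gt k)))// -natrX ler_nat ltnW// ltn_expl//.
exists m%:R; split; first by rewrite ltr0n.
move=> /cvgrPdist_lt Vlim.
pose L := M ^+ m * tail V M.
have L0 : 0 < L by rewrite mulr_gt0 ?exprn_gt0 ?V0 ?ltW.
have grow n : L <= (2 ^+ n * M) ^+ m * tail V (2 ^+ n * M).
  elim: n => [|n IHn]; first by rewrite expr0 mul1r.
  rewrite exprS -mulrA; move: IHn; set y := 2 ^+ n * M => IHn.
  have My : M <= y by rewrite /y ler_peMl ?(ltW M0)// exprn_ege1// ler1n.
  have y0 : 0 <= y by rewrite (le_trans (ltW M0)).
  clearbody y.
  have := HM (2 * y); rewrite mulKf ?pnatr_eq0// !ger0_norm ?tail_ge0// => step.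
  apply: (le_trans IHn).
  rewrite exprMn [2 ^+ m * _]mulrC -mulrA ler_wpM2l ?exprn_ge0//.
  apply: (le_trans (step _)); first lra.
  by rewrite ler_wpM2r ?tail_ge0.
have /near_pinftyP[N [N0 HN]] := Vlim _ L0.
pose n := (Num.truncn (N / M)).+1.
have Nn : N <= 2 ^+ n * M.
  rewrite -ler_pdivrMr// (le_trans (ltW (truncnS_gt _)))//.
  by rewrite -natrX ler_nat ltnW// ltn_expl.
have := HN _ Nn; rewrite sub0r normrN.
rewrite powR_mulrn ?mulr_ge0 ?exprn_ge0 ?(ltW M0)//.
by move=> /(le_lt_trans (ler_norm _)); rewrite ltNge grow.
Qed.

Lemma tail_mul_rapid (R : realType) (d : measure_display)
    (T : measurableType d) (P : probability T R) (X Y : {RV P >-> R})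
    (delta : R) :
  distribution P X `]-oo, 0[%classic = 0%E ->
  distribution P Y `]-oo, 0[%classic = 0%E ->
  x `^ (2 * delta) *
    Num.max (tail (distribution P Y) x) (tail (distribution P X) x)
    @[x --> +oo] --> (0 : R) ->
  x `^ delta * tail (distribution P (X \* Y : {RV P >-> R})) x
    @[x --> +oo] --> (0 : R).
Proof.
move=> X0 Y0 /cvgrPdist_le max0; apply/cvgrPdist_le => eps eps0.
have eps20 : 0 < eps / 2 by rewrite divr_gt0.
have /near_pinftyP[M [M0 HM]] := max0 _ eps20.
near=> x.
have Mx : M ^+ 2 <= x by near: x; apply: nbhs_pinfty_ge; exact: num_real.
have x0 : 0 <= x by rewrite (le_trans _ Mx)// sqr_ge0.
pose z := Num.sqrt x.
have z0 : 0 <= z by exact: sqrtr_ge0.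
have xz : x = z ^+ 2 by rewrite sqr_sqrtr.
have Mz : M <= z by rewrite -(ger0_norm (ltW M0)) -sqrtr_sqr ler_wsqrtr.
have := HM _ Mz; rewrite !sub0r !normrN !ger0_norm; last 2 first.
- by rewrite mulr_ge0 ?powR_ge0 ?tail_ge0.
- by rewrite mulr_ge0 ?powR_ge0// le_max tail_ge0.
rewrite xz -[in X in _ -> X](powR_mulrn 2 z0) -powRrM powR_mulrn// => max_le.
apply: (@le_trans _ _ (z `^ (2 * delta) *
    (tail (distribution P X) z + tail (distribution P Y) z))).
  by rewrite ler_wpM2l ?powR_ge0// tail_mul_le.
have p0 := powR_ge0 z (2 * delta).
have Gmax : z `^ (2 * delta) * tail (distribution P Y) z <= eps / 2.
  by apply: le_trans max_le; rewrite ler_wpM2l// le_max lexx.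
have Fmax : z `^ (2 * delta) * tail (distribution P X) z <= eps / 2.
  by apply: le_trans max_le; rewrite ler_wpM2l// le_max lexx orbT.
by rewrite mulrDr (splitr eps) lerD.
Unshelve. all: by end_near. Qed.

(** * Tail asymptotics of the product *)

Theorem proposition1p1 (R : realType) (d : measure_display)
  (T : measurableType d) (P : probability T R) (X Y : {RV P >-> R})
  (F G H : probability R R)
  (hXY : independent_RVs X Y)
  (hF : F = (distribution P X : probability R R))
  (hG : G = (distribution P Y : probability R R))
  (hH : H = (distribution P (X \* Y : {RV P >-> R}) : probability R R))
  (hF0 : supported_on_nonneg F) (hG0 : supported_on_nonneg G) :
  (* (i) *)
  (((exists delta : R,
        0 < delta /\ x `^ delta * tail H x @[x --> +oo] --> +oo)
      <-> dominates_light_tails H)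
   /\ (forall delta1 : R, 0 < delta1 ->
        x `^ delta1 * tail F x @[x --> +oo] --> +oo ->
        [/\ x `^ delta1 * tail H x @[x --> +oo] --> +oo,
            dominates_light_tails H,
            (forall V : probability R R, all_moments_finite V ->
               forall c : R, 0 < c ->
               (fun x : R => tail V (c * x)) =o_ (pinfty_nbhs R) (tail H))
          & (long_tailed F -> all_moments_finite G -> long_tailed H)]))
  (* (ii) *)
  /\ ((forall delta : R, 0 < delta ->
         x `^ delta * Num.max (tail G x) (tail F x) @[x --> +oo] --> (0 : R)) ->
      (forall delta : R, 0 < delta ->
         x `^ delta * tail H x @[x --> +oo] --> (0 : R))
      /\ ~ dominatedly_varying H).
Proof.
have FG_H x : 0 <= x -> tail F x * tail G 1 <= tail H x.
  by move=> x0; rewrite hF hG hH -[in leRHS](mulr1 x) tail_mul_ge.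
have H0 x : 0 <= x -> 0 < tail H x.
  by move=> x0; rewrite (lt_le_trans _ (FG_H _ x0))// mulr_gt0 ?hF0.2 ?hG0.2.
have scaled delta : 0 < delta -> x `^ delta * tail H x @[x --> +oo] --> +oo ->
    forall V : probability R R, all_moments_finite V -> forall c : R, 0 < c ->
    (fun x : R => tail V (c * x)) =o_ (pinfty_nbhs R) (tail H).
  move=> d0 Hoo V Vlight c c0.
  exact: light_tail_eqo (@tail_ge0 _ H) d0 c0 Vlight Hoo.
have dominates delta : 0 < delta ->
    x `^ delta * tail H x @[x --> +oo] --> +oo -> dominates_light_tails H.
  move=> d0 Hoo V Vlight; have := scaled _ d0 Hoo _ Vlight _ ltr01.
  by under eq_fun do rewrite mul1r.
split; [split|].
- split=> [[delta [d0 Hoo]]|]; first exact: dominates Hoo.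
  exact: dominates_light_tails_moment.
- move=> delta d0 Foo.
  have Hoo : x `^ delta * tail H x @[x --> +oo] --> +oo.
    apply/cvgryPge => A; near=> x.
    have x0 : 0 <= x by near: x; apply: nbhs_pinfty_ge; exact: num_real.
    apply: (@le_trans _ _ (x `^ delta * (tail F x * tail G 1))); last first.
      by rewrite ler_wpM2l ?powR_ge0 ?FG_H.
    rewrite mulrA -ler_pdivrMr ?hG0.2//.
    by near: x; move/cvgryPge : Foo; exact.
  split=> //; [exact: dominates Hoo|exact: scaled Hoo|].
  rewrite hF hG hH in hF0 hG0 Hoo *.
  exact: tail_mul_long_tailed Hoo.
- move=> rapid.
  have Hrapid delta : 0 < delta ->
      x `^ delta * tail H x @[x --> +oo] --> (0 : R).
    move=> d0; have := rapid (2 * delta); rewrite mulr_gt0// => /(_ isT).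
    rewrite hF hG hH in hF0 hG0 *.
    exact: tail_mul_rapid hF0.1 hG0.1.
  split=> // HD.
  have [delta [d0]] := dominatedly_varying_power H0 HD.
  by apply; exact: Hrapid.
Unshelve. all: by end_near. Qed.
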